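(* For a given prime $p \neq 2$, the number of two-cycles modulo $p^e$, denoted $|T_e|$, is $$|T_e| = \sum_{m \mid (p-1)} \phi(m)\, p^{e-1}(p-1)(m-1)/2.$$
   Context: Here $e$ is a positive integer, $\phi$ is Euler's totient function, and the sum runs over the positive divisors $m$ of $p-1$. For a fixed prime $p$ and some $g \in \mathbb{Z}$ with $p \nmid g$, a pair $(h,a) \in \{1, \ldots, p^e(p-1)\}^2$ with $p \nmid h$ and $p \nmid a$ is a two-cycle modulo $p^e$ associated with $g$ if $h \not\equiv a \pmod{p^e}$, $g^h \equiv a \pmod{p^e}$ and $g^a \equiv h \pmod{p^e}$. When counting two-cycles modulo $p^e$, the two-cycles $(h,a)$ and $(a,h)$ are not distinguished. Thus the number of two-cycles modulo $p^e$ is defined as $$|T_e| = \frac{1}{2}\Bigl|\Bigl\{ h \in \{1, \ldots, p^e(p-1)\},\ p \nmid h \ \Big|\ h \not\equiv a \pmod{p^e},\ g^h \equiv a \pmod{p^e}, \text{ and } g^a \equiv h \pmod{p^e} \text{ for some } g \in (\mathbb{Z}/p^e\mathbb{Z})^\times \text{ and } a \in \{1, \ldots, p^e(p-1)\},\ p \nmid a \Bigr\}\Bigr|.$$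
   Formalization: |T_e| is taken as half the number of pairs (g,h), each h counted once for every base g, rather than half the number of h occurring for some g; the latter is at most 8 for p=5, e=1, while the formula gives 14. *)

(* Defs.v *)
From mathcomp Require Import all_boot all_order all_algebra.

Set Implicit Arguments.
Unset Strict Implicit.
Unset Printing Implicit Defensive.

Import GRing.Theory.
Local Open Scope ring_scope.

(* Residues mod p ^ e live in 'Z_(p ^ e), which is Z / p^e only when
   1 < p ^ e; this holds whenever p is prime and 0 < e. *)

Definition two_cycle_range (p e : nat) : nat := (p ^ e * (p - 1))%N.

Definition in_range (p e h : nat) : bool :=
  [&& (1 <= h)%N, (h <= two_cycle_range p e)%N & ~~ (p %| h)%N].

Definition is_two_cycle (p e : nat) (g : {unit 'Z_(p ^ e)}) (h a : nat) : bool :=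
  [&& in_range p e h, in_range p e a,
      h != a %[mod p ^ e],
      val g ^+ h == a%:R
    & val g ^+ a == h%:R].

(* Ordinals below (two_cycle_range p e).+1 are used so that the upper endpoint
   p^e (p - 1) is representable; is_two_cycle excludes 0. *)
Definition two_cycle_points (p e : nat) (g : {unit 'Z_(p ^ e)}) :
    {set 'I_(two_cycle_range p e).+1} :=
  [set h : 'I_(two_cycle_range p e).+1 |
    [exists a : 'I_(two_cycle_range p e).+1, is_two_cycle g h a]].

(* |T_e|: a two-cycle is always associated with a given base g, so a point h is
   counted once for each base g of which it is a two-cycle point, i.e. the
   point sets of the different g are joined disjointly. (Collapsing them into
   one set of integers h would give 15/2 for p = 5, e = 1.) The factor 1/2
   identifies (h, a) with (a, h). *)
Definition num_two_cycles (p e : nat) : rat :=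
  2^-1 * #|[set gh : {unit 'Z_(p ^ e)} * 'I_(two_cycle_range p e).+1 |
             gh.2 \in two_cycle_points gh.1]|%:R.

(* Main.v *)
Require Import Defs.
From mathcomp Require Import all_boot all_order all_fingroup all_algebra.
From mathcomp Require Import all_solvable.

(** Fix a base [g] and let [m] be the order of [g] modulo [p], so [m] divides
    [p - 1].  The pair of equations [g ^ h = a], [g ^ a = h] modulo [p ^ e]
    says that [h] and [a] are swapped by [x |-> g ^ x].  Once the residue of
    the exponent modulo [p - 1] is prescribed this map is a [p]-adic
    contraction: if [i] and [j] agree modulo [p - 1] and modulo [p ^ k], then
    [g ^ i] and [g ^ j] agree modulo [p ^ (k + 1)]
    ([eqn_mod_expn_exponent]).  Hence, for any prescribed residues [i] of [h]
    and [j] of [a], the system has exactly one solution modulo [p ^ e]: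
    iterating the map [e] times from [(i, j)] produces it
    ([exp_swap_approxP]), and two solutions agree modulo [p ^ k] for
    [k = 0, ..., e] in turn ([exp_swap_unique]).  Already the
    residues modulo [m] determine the solution, because [g ^ m = 1] modulo [p].

    A two-cycle point [h] lies in a range of [p ^ e * (p - 1)] integers, so by
    the Chinese remainder theorem it is given by its residues modulo [p - 1]
    and [p ^ e], that is, by [i] in Z/(p - 1) together with the residue [j] of
    its partner modulo [m].  The condition that [h] and [a] differ modulo
    [p ^ e] becomes that [i] and [j] differ modulo [m], so [g] has
    [(p - 1) * (m - 1)] points ([card_two_cycle_points]).

    It remains to sum over the bases.  Reduction modulo [p] is
    [p ^ (e - 1)]-to-one on units ([sum_unit_mod_prime]), and the unit group of
    the field with [p] elements is cyclic of order [p - 1], so it has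
    [totient m] elements of order [m] for each divisor [m] of [p - 1]
    ([sum_order_cyclic]). *)

Set Implicit Arguments.
Unset Strict Implicit.
Unset Printing Implicit Defensive.
Local Open Scope nat_scope.

(** * Powers as contracting functions of the exponent *)

(** Raising [y = 1 %[mod p ^ k.+1]] to the power [p] gains one factor [p]:
    [y ^ p - 1 = (y - 1) * (1 + y + ... + y ^ (p - 1))], and the second factor
    is a sum of [p] terms congruent to 1 modulo [p]. *)
Lemma expn_eq1_mod_lift (p x k : nat) :
  0 < p -> x = 1 %[mod p] -> x ^ p ^ k = 1 %[mod p ^ k.+1].
Proof.
move=> p_gt0 x1; elim: k => [|k IHk]; first by rewrite expn0 !expn1.
(* For x = 0 the hypothesis forces p = 1; otherwise natural subtraction of 1
   from the powers of x is exact. *)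
have [x0|x_gt0] := posnP x.
  move: x1; rewrite x0 mod0n => /esym/eqP; rewrite -/(p %| 1) dvdn1 => /eqP ->.
  by rewrite !exp1n !modn1.
have xk_gt0 j : 0 < x ^ j by rewrite expn_gt0 x_gt0.
apply/eqP; rewrite eqn_mod_dvd // (expnSr p k) expnM subn1 predn_exp.
rewrite (expnSr p k.+1) dvdn_mul //.
  by rewrite -subn1 -eqn_mod_dvd //; apply/eqP.
have y1 : x ^ p ^ k = 1 %[mod p] by rewrite -modnXm x1 modnXm exp1n.
rewrite /dvdn -modn_summ.
under eq_bigr => i _ do rewrite -modnXm y1 modnXm exp1n.
by rewrite modn_summ sum1_card card_ord modnn.
Qed.

(** The contraction property: the agreement of [x ^ i] and [x ^ j] is one
    [p]-adic digit longer than that of [i] and [j]. *)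
Lemma eqn_mod_expn_exponent (p m x k i j : nat) :
    0 < p -> x ^ m = 1 %[mod p] -> i = j %[mod p ^ k * m] ->
  x ^ i = x ^ j %[mod p ^ k.+1].
Proof.
move=> p_gt0 xm1; wlog le_ij : i j / i <= j => [hw eq_ij|].
  by case: (leqP i j) => [|/ltnW] le; [|symmetry]; apply: hw.
move/esym/eqP; rewrite eqn_mod_dvd // => /dvdnP[q def_q].
rewrite -(subnKC le_ij) {}def_q expnD.
have -> : q * (p ^ k * m) = m * p ^ k * q by rewrite mulnC (mulnC m).
rewrite 2!expnM -modnMmr -[X in _ * X]modnXm expn_eq1_mod_lift //.
by rewrite modnXm exp1n modnMmr muln1.
Qed.

(** * Solving the two-cycle equations modulo a prime power *)

Definition exp_swap (n x h a : nat) : Prop :=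
  x ^ h = a %[mod n] /\ x ^ a = h %[mod n].

(** By contraction, agreement of the exponents modulo [p ^ k] and [m] makes
    the powers, hence the other two exponents, agree modulo [p ^ k.+1]. *)
Lemma exp_swap_unique (p e m x h a h' a' : nat) :
    0 < p -> coprime p m -> x ^ m = 1 %[mod p] ->
    exp_swap (p ^ e) x h a -> exp_swap (p ^ e) x h' a' ->
    h = h' %[mod m] -> a = a' %[mod m] ->
  h = h' %[mod p ^ e] /\ a = a' %[mod p ^ e].
Proof.
move=> p_gt0 co_pm xm1 [xh xa] [xh' xa'] eq_h eq_a.
suff IH k : k <= e -> h = h' %[mod p ^ k] /\ a = a' %[mod p ^ k] by apply: IH.
elim: k => [|k IHk] lt_ke; first by rewrite expn0 !modn1.
have [eq_hk eq_ak] := IHk (ltnW lt_ke).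
(* From h to a and from a to h the argument is the same. *)
have step u v u' v' : u = u' %[mod p ^ k] -> u = u' %[mod m] ->
    x ^ u = v %[mod p ^ e] -> x ^ u' = v' %[mod p ^ e] -> v = v' %[mod p ^ k.+1].
  move=> eq_uk eq_um xu xu'; have dv := dvdn_exp2l p lt_ke.
  rewrite -(modn_dvdm v dv) -xu -(modn_dvdm v' dv) -xu' !modn_dvdm //.
  apply: (eqn_mod_expn_exponent (m := m)) => //; apply/eqP.
  by rewrite chinese_remainder ?coprimeXl // eq_uk eq_um !eqxx.
by split; [apply: step xa xa' | apply: step xh xh'].
Qed.

Section SwapSolution.
Variables (p e n x : nat).
Hypotheses (p_gt0 : 0 < p) (co_pn : coprime p n) (xn1 : x ^ n = 1 %[mod p]).

(** The pair [(exp_swap_approx k i j, exp_swap_approx k j i)] is the [k]-th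
    iterate of [(h, a) |-> (x ^ a, x ^ h)] from [(i, j)], corrected at each
    step to keep the residues of [i] and [j] modulo [n].  One function serves
    for both coordinates, by exchanging [i] and [j] at each step. *)
Fixpoint exp_swap_approx (k i j : nat) : nat :=
  if k is k'.+1 then
    chinese (p ^ e) n (x ^ exp_swap_approx k' j i) i %% (p ^ e * n)
  else i.

Lemma exp_swap_approx_mod (k i j : nat) : exp_swap_approx k i j = i %[mod n].
Proof.
case: k => [|k] /=; first by []; rewrite modn_dvdm ?dvdn_mull //.
by rewrite chinese_modr // coprimeXl.
Qed.

Lemma exp_swap_approxS (k i j : nat) :
  exp_swap_approx k.+1 i j = x ^ exp_swap_approx k j i %[mod p ^ e].
Proof. by rewrite /= modn_dvdm ?dvdn_mulr // chinese_modl // coprimeXl. Qed.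

(** The iterates converge [p]-adically, gaining a digit at each step. *)
Lemma exp_swap_approx_stable (k i j : nat) :
    k <= e ->
  exp_swap_approx k.+1 i j = exp_swap_approx k i j %[mod p ^ k].
Proof.
elim: k i j => [|k IHk] i j lt_ke; first by rewrite expn0 !modn1.
have dv := dvdn_exp2l p lt_ke.
rewrite -(modn_dvdm (exp_swap_approx k.+2 i j) dv) exp_swap_approxS.
rewrite -(modn_dvdm (exp_swap_approx k.+1 i j) dv) exp_swap_approxS.
rewrite !modn_dvdm //; apply: (eqn_mod_expn_exponent (m := n)) => //.
apply/eqP; rewrite chinese_remainder ?coprimeXl //; apply/andP; split; apply/eqP.
  exact/IHk/ltnW.
by rewrite !exp_swap_approx_mod.
Qed.

Lemma exp_swap_approxP (i j : nat) :
  exp_swap (p ^ e) x (exp_swap_approx e i j) (exp_swap_approx e j i).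
Proof.
by split; rewrite -exp_swap_approxS; apply: exp_swap_approx_stable.
Qed.

Lemma ltn_exp_swap_approx (k i j : nat) :
  0 < n -> exp_swap_approx k.+1 i j < p ^ e * n.
Proof. by move=> n_gt0; rewrite ltn_pmod // muln_gt0 expn_gt0 p_gt0. Qed.
End SwapSolution.

(** * Elements of given order in a cyclic group *)

(** A cyclic group has a single subgroup of order [m], so the elements of
    order [m] are the generators of that subgroup. *)
Lemma card_order_cyclic (gT : finGroupType) (G : {group gT}) (m : nat) :
  cyclic G -> m %| #|G| -> #|[set x in G | #[x]%g == m]| = totient m.
Proof.
move=> cycG; have [x defG] := cyclicP cycG; rewrite {1}defG => dv_m.
have xG : x \in G by rewrite defG cycle_id.
pose y := (x ^+ (#[x] %/ m))%g.
have oy : #[y]%g = m by rewrite orderXdiv ?dvdn_div // divnA // mulKn ?order_gt0.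
have yG : y \in G by rewrite groupX.
rewrite -oy totient_gen; apply: eq_card => z; rewrite !inE /generator.
apply/andP/eqP => [[zG /eqP oz]|eq_yz].
  by apply/eqP; rewrite (eq_subG_cyclic cycG) ?cycle_subG // -!orderE oz.
have zG : z \in G by rewrite -cycle_subG -eq_yz cycle_subG.
by rewrite zG /order eq_yz.
Qed.

Lemma sum_order_cyclic (gT : finGroupType) (G : {group gT}) (f : nat -> nat) :
    cyclic G ->
  \sum_(x in G) f #[x]%g = \sum_(m <- divisors #|G|) totient m * f m.
Proof.
move=> cycG.
transitivity (\sum_(m <- divisors #|G|) \sum_(x in G | #[x]%g == m) f m).
  rewrite (exchange_big_dep (mem G)) /=; last by move=> m x _ /andP[].
  apply: eq_bigr => x xG; under eq_bigl => m do rewrite xG eq_sym /=.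
  rewrite -big_filter filter_pred1_uniq ?divisors_uniq ?big_seq1 //.
  by rewrite -dvdn_divisors ?cardG_gt0 ?order_dvdG.
rewrite big_seq_cond [RHS]big_seq_cond; apply: eq_bigr => m.
rewrite andbT -dvdn_divisors ?cardG_gt0 // => dv_m.
rewrite sum_nat_cond_const -(card_order_cyclic cycG dv_m).
by congr (_ * _).
Qed.

(** * Two-cycle points of a fixed base *)

Lemma card_pairs_neq_mod (n m : nat) :
    0 < m ->
  #|[set ij : 'I_n * 'I_m | ij.1 != ij.2 %[mod m]]| = n * (m - 1).
Proof.
move=> m_gt0; rewrite -sum1dep_card.
rewrite -(pair_big_dep xpredT
  (fun (i : 'I_n) (j : 'I_m) => i != j %[mod m]) (fun _ _ => 1)) /=.
rewrite -[n in RHS]card_ord -sum_nat_const; apply: eq_bigr => i _.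
have lt_im : i %% m < m by rewrite ltn_pmod.
rewrite sum1dep_card subn1 -[X in _ = X.-1]card_ord -(cardC1 (Ordinal lt_im)).
by apply: eq_card => j; rewrite !inE -val_eqE /= (modn_small (ltn_ord j)) eq_sym.
Qed.

Section Base.
Variables (p e : nat).
Hypotheses (p_pr : prime p) (e_gt0 : 0 < e).

Let pe_gt1 : 1 < p ^ e.
Proof. by rewrite -(expn0 p) ltn_exp2l ?prime_gt1. Qed.

(** Working with the representative in [nat] turns the equations in
    ['Z_(p ^ e)] into congruences, which can be reduced modulo the
    intermediate [p ^ k]. *)
Definition base_nat (g : {unit 'Z_(p ^ e)}) : nat := val (val g).

Lemma coprime_base_nat (g : {unit 'Z_(p ^ e)}) : coprime p (base_nat g).
Proof.
have := valP g; rewrite -[val g]natr_Zp unitZpE //.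
by rewrite coprime_pexpl.
Qed.

(** Since [base_nat g] is prime to [p], the default value of [insubd] is never
    taken; see [val_unit_mod_prime]. *)
Definition unit_mod_prime (g : {unit 'Z_(p ^ e)}) : {unit 'F_p} :=
  insubd (1%g : {unit 'F_p}) ((base_nat g)%:R%R : 'F_p).

Lemma val_unit_mod_prime (g : {unit 'Z_(p ^ e)}) :
  val (unit_mod_prime g) = ((base_nat g)%:R)%R.
Proof. by rewrite insubdK // unfold_in /= unitFpE // coprime_base_nat. Qed.

Lemma eqn_mod_base_nat (g : {unit 'Z_(p ^ e)}) (i j : nat) :
  (base_nat g ^ i == base_nat g ^ j %[mod p])
  = (i == j %[mod #[unit_mod_prime g]%g]).
Proof.
rewrite -eq_expg_mod_order -(inj_eq val_inj) /= !FinRing.val_unitX.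
rewrite !val_unit_mod_prime -!GRing.natrX -(inj_eq val_inj) /=.
by rewrite !val_Fp_nat.
Qed.

Lemma card_unit_Fp : #|[set: {unit 'F_p}]| = p - 1.
Proof. by rewrite card_finField_unit card_Fp // subn1. Qed.

Lemma is_two_cycleP (g : {unit 'Z_(p ^ e)}) (h a : nat) :
  reflect [/\ in_range p e h, in_range p e a, h != a %[mod p ^ e]
             & exp_swap (p ^ e) (base_nat g) h a] (is_two_cycle g h a).
Proof.
have eq_pow i j : (val g ^+ i == j%:R)%R = (base_nat g ^ i == j %[mod p ^ e]).
  rewrite -[val g]natr_Zp -GRing.natrX -(inj_eq val_inj) /=.
  by rewrite !(val_Zp_nat pe_gt1).
rewrite /is_two_cycle !eq_pow; apply: (iffP and5P) => [[hr ar ha /eqP xh /eqP xa]|].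
  by split.
by case=> hr ar ha [xh xa]; split=> //; apply/eqP.
Qed.

Lemma coprime_expn_congr (x h a : nat) :
  coprime p x -> x ^ a = h %[mod p ^ e] -> ~~ (p %| h).
Proof.
move=> co_px xa; rewrite -prime_coprime //.
have dv : p %| p ^ e by rewrite dvdn_exp.
by rewrite -coprime_modr -(modn_dvdm h dv) -xa modn_dvdm // coprime_modr coprimeXr.
Qed.

(** The points of [g] are parametrized by the pairs [(i, j)] with [i] in
    Z/(p - 1), [j] in Z/m and [i != j %[mod m]]: the residue [j] of the partner
    of [h] is determined by [h], because [g ^ a = h] modulo [p].  Only the
    residue modulo [m] of the partner matters, so different partners of the
    same [h] in the range do not produce further points. *)
Lemma card_two_cycle_points (g : {unit 'Z_(p ^ e)}) :
  #|two_cycle_points g| = (p - 1) * (#[unit_mod_prime g]%g - 1).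
Proof.
set m := #[_]%g; have m_gt0 : 0 < m by apply: order_gt0.
pose n := p - 1; pose x := base_nat g.
have p_gt0 := prime_gt0 p_pr.
have n_gt0 : 0 < n by rewrite subn_gt0 prime_gt1.
have dv_mn : m %| n by rewrite /n -card_unit_Fp order_dvdG ?inE.
have co_pn : coprime p n by rewrite /n subn1 coprimenP.
have co_pm : coprime p m by apply: coprime_dvdr dv_mn co_pn.
have co_px : coprime p x by apply: coprime_base_nat.
have eq_xm i j : (x ^ i == x ^ j %[mod p]) = (i == j %[mod m]).
  exact: eqn_mod_base_nat.
have xm1 : x ^ m = 1 %[mod p].
  by apply/eqP; rewrite -(expn0 x) eq_xm modnn mod0n.
have xn1 : x ^ n = 1 %[mod p].
  by apply/eqP; rewrite -(expn0 x) eq_xm mod0n.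
pose pt := exp_swap_approx p e n x e.
have swap_pt i j : exp_swap (p ^ e) x (pt i j) (pt j i) by apply: exp_swap_approxP.
have pt_n i j : pt i j = i %[mod n] by apply: exp_swap_approx_mod.
have pt_m i j : pt i j = i %[mod m].
  by rewrite -(modn_dvdm (pt i j) dv_mn) pt_n modn_dvdm.
have lt_pt i j : pt i j < two_cycle_range p e.
  by rewrite /pt -(prednK e_gt0) ltn_exp_swap_approx // ?prednK.
pose D := [set ij : 'I_n * 'I_m | ij.1 != ij.2 %[mod m]].
pose F (ij : 'I_n * 'I_m) : 'I_(two_cycle_range p e).+1 := inord (pt ij.1 ij.2).
have val_F ij : F ij = pt ij.1 ij.2 :> nat by rewrite inordK // ltnW // ltnS.
have dv_pe : p %| p ^ e by rewrite dvdn_exp.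
(* The residues of h and a modulo p are those of g ^ a and g ^ h. *)
have neq_pt i j : i != j %[mod m] -> pt i j != pt j i %[mod p ^ e].
  apply: contraNneq => eq_pt; rewrite eq_sym -(pt_m i j) -(pt_m j i) -eq_xm.
  have [xh xa] := swap_pt i j.
  rewrite -(modn_dvdm (x ^ pt j i) dv_pe) xa -(modn_dvdm (x ^ pt i j) dv_pe) xh.
  by rewrite eq_pt.
have F_inj : {in D &, injective F}.
  move=> [i j] [i' j'] _ _ /(congr1 val) /=; rewrite !val_F /= => eq_pt.
  have eq_i : i = i'.
    apply: val_inj; rewrite /= -(modn_small (ltn_ord i)) -(modn_small (ltn_ord i')).
    by rewrite -(pt_n i j) -(pt_n i' j') eq_pt.
  congr (_, _) => //; apply: val_inj => /=.
  rewrite -(modn_small (ltn_ord j)) -(modn_small (ltn_ord j')).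
  rewrite -(pt_m j i) -(pt_m j' i'); apply/eqP; rewrite -eq_xm; apply/eqP.
  have [_ xa] := swap_pt i j; have [_ xa'] := swap_pt i' j'.
  rewrite -(modn_dvdm (x ^ pt j i) dv_pe) xa -(modn_dvdm (x ^ pt j' i') dv_pe) xa'.
  by rewrite eq_pt.
have in_rangeP h a :
    h < two_cycle_range p e -> x ^ a = h %[mod p ^ e] -> in_range p e h.
  move=> lt_h xa; have ndv := coprime_expn_congr co_px xa.
  rewrite /in_range ndv (ltnW lt_h) lt0n; apply/and3P; split=> //.
  by apply: contraNneq ndv => ->; rewrite dvdn0.
rewrite -(card_pairs_neq_mod n m_gt0) -/D -(card_in_imset F_inj).
apply: eq_card => h; rewrite inE; apply/existsP/imsetP => [[a]|[[i j] ijD ->]].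
  case/is_two_cycleP => hr ar neq_ha swap_ha; have [xh xa] := swap_ha.
  have lt_i : h %% n < n by rewrite ltn_pmod.
  have lt_j : a %% m < m by rewrite ltn_pmod.
  have unique_pt h' a' : exp_swap (p ^ e) x h' a' -> h = h' %[mod m] ->
      a = a' %[mod m] -> h = h' %[mod p ^ e].
    move=> sw eqh eqa.
    by have [] := exp_swap_unique p_gt0 co_pm xm1 swap_ha sw eqh eqa.
  exists (Ordinal lt_i, Ordinal lt_j).
    (* If i and j agreed modulo m, uniqueness would identify the solutions
       (h, a) and (a, h). *)
    rewrite inE /= modn_mod modn_dvdm //; apply: contraNneq neq_ha => eq_ha.
    by apply/eqP/(unique_pt a h (conj xa xh)).
  have eq_h : h = pt (h %% n) (a %% m) %[mod p ^ e].
    apply: unique_pt (swap_pt _ _) _ _; first by rewrite pt_m modn_dvdm.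
    by rewrite pt_m modn_mod.
  (* The upper end of the range is a multiple of p, so it is not a point. *)
  have lt_h : h < two_cycle_range p e.
    have /and3P[_ le_h ndv_h] := hr; rewrite ltn_neqAle le_h andbT.
    by apply: contraNneq ndv_h => ->; rewrite /two_cycle_range dvdn_mulr.
  apply: val_inj; rewrite /= val_F /=.
  rewrite -[LHS](modn_small lt_h) -[RHS](modn_small (lt_pt _ _)).
  apply/eqP; rewrite chinese_remainder ?coprimeXl //.
  by apply/andP; split; apply/eqP; rewrite ?pt_n ?modn_mod.
have [xh xa] := swap_pt i j.
have lt_ji := lt_pt j i; exists (Ordinal (ltnW lt_ji : pt j i < _.+1)).
apply/is_two_cycleP; rewrite val_F /=; split=> //.
- exact: in_rangeP xa.
- exact: in_rangeP xh.
- by apply: neq_pt; rewrite inE in ijD.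
Qed.

(** * Summation over the bases *)

(** The units above [u] are [k * p + u] for [k < p ^ (e - 1)]: they are
    distinct, and by the value of [totient (p ^ e)] there are no others. *)
Lemma sum_unit_mod_prime (f : {unit 'F_p} -> nat) :
  \sum_g f (unit_mod_prime g) = p ^ (e - 1) * \sum_u f u.
Proof.
have p_gt0 := prime_gt0 p_pr.
pose nat_u (u : {unit 'F_p}) : nat := val (val u).
have lt_u u : nat_u u < p by rewrite /nat_u -[X in _ < X](Fp_cast p_pr) ltn_ord.
pose lift_nat (ku : 'I_(p ^ (e - 1)) * {unit 'F_p}) := ku.1 * p + nat_u ku.2.
have lift_modp ku : lift_nat ku %% p = nat_u ku.2.
  by rewrite modnMDl modn_small.
have lt_lift ku : lift_nat ku < p ^ e.
  have -> : p ^ e = p ^ (e - 1) * p by rewrite -expnSr subn1 prednK.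
  by rewrite -ltn_divLR // divnMDl // divn_small // addn0.
have co_lift ku : coprime p (lift_nat ku).
  rewrite -coprime_modr lift_modp -unitFpE //.
  by rewrite /nat_u natr_Zp (valP ku.2).
have unit_lift ku : ((lift_nat ku)%:R%R : 'Z_(p ^ e)) \is a GRing.unit.
  by rewrite unitZpE // coprime_pexpl.
pose lift_unit ku : {unit 'Z_(p ^ e)} := FinRing.Unit (unit_lift ku).
have base_lift ku : base_nat (lift_unit ku) = lift_nat ku.
  by rewrite /base_nat /= val_Zp_nat // modn_small.
have lift_mod ku : unit_mod_prime (lift_unit ku) = ku.2.
  apply/val_inj/val_inj; rewrite val_unit_mod_prime base_lift /=.
  by rewrite val_Fp_nat.
have lift_inj : injective lift_unit.
  move=> [k u] [k' u'] eq_ku; have := congr1 base_nat eq_ku; rewrite !base_lift.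
  have := congr1 unit_mod_prime eq_ku; rewrite !lift_mod /= => -> /eqP.
  by rewrite /lift_nat /= eqn_add2r eqn_pmul2r // => /eqP/val_inj ->.
have lift_bij : bijective lift_unit.
  apply: inj_card_bij => //; rewrite card_prod card_ord.
  rewrite -!cardsT card_unit_Fp -/(units_Zp (p ^ e)).
  rewrite card_units_Zp ?expn_gt0 ?p_gt0 //.
  by rewrite totient_pfactor // mulnC !subn1.
rewrite (reindex lift_unit) /=; last exact: onW_bij.
under eq_bigr => ku _ do rewrite lift_mod.
rewrite -(pair_big xpredT xpredT (fun _ u => f u)) /=.
by rewrite sum_nat_const card_ord.
Qed.

Lemma card_two_cycle_pairs :
  #|[set gh : {unit 'Z_(p ^ e)} * 'I_(two_cycle_range p e).+1 |
      gh.2 \in two_cycle_points gh.1]|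
  = \sum_(m <- divisors (p - 1)) totient m * p ^ (e - 1) * (p - 1) * (m - 1).
Proof.
rewrite -sum1dep_card.
rewrite -(pair_big_dep xpredT
  (fun (g : {unit 'Z_(p ^ e)}) h => h \in two_cycle_points g)
  (fun _ _ => 1)) /=.
under eq_bigr => g _ do rewrite sum1_card card_two_cycle_points.
rewrite (sum_unit_mod_prime (fun u => (p - 1) * (#[u]%g - 1))).
have cycU := field_unit_group_cyclic [set: {unit 'F_p}].
have := sum_order_cyclic (fun m => (p - 1) * (m - 1)) cycU.
rewrite card_unit_Fp; under eq_bigl => u do rewrite inE.
move=> ->; rewrite big_distrr /=; apply: eq_bigr => m _.
by rewrite mulnA (mulnC (p ^ _)) !mulnA.
Qed.
End Base.

Local Open Scope ring_scope.

Theorem theorem12 (p e : nat) (p_prime : prime p) (p_neq2 : p != 2%N)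
    (e_gt0 : (0 < e)%N) :
  num_two_cycles p e =
    \sum_(m <- divisors (p - 1))
      (totient m)%:R * p%:R ^+ (e - 1) * (p%:R - 1) * (m%:R - 1) / 2.
Proof.
rewrite /num_two_cycles card_two_cycle_pairs // GRing.natr_sum GRing.mulr_sumr.
apply: eq_big_seq => m; rewrite -dvdn_divisors ?subn_gt0 ?prime_gt1 // => dv_m.
have m_gt0 : (0 < m)%N by rewrite (dvdn_gt0 _ dv_m) // subn_gt0 prime_gt1.
by rewrite GRing.mulrC !GRing.natrM GRing.natrX !GRing.natrB // prime_gt0.
Qed.
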